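(* Let $g:[0,\infty)\to[1,\infty]$ be a function with $g(0)<\infty$ such that $\ell\mapsto g(\ell)-\ell$ is increasing (in the weak sense). Suppose there exists $\alpha\in(0,1)$ such that $$1-\frac{g(0)-1}{g(0)}\exp\left(-\int_0^\infty\frac{1}{g(\ell)}\,\mathrm{d}\ell\right)=\alpha .$$ Then $g(0)\ge 1/\alpha$. Additionally, if $g(0)=1/\alpha$, then $g(\ell)=\infty$ for all $\ell>0$. Contrapositively, if $g(\ell)$ is finite for some $\ell>0$, then $g(0)>1/\alpha$.
   Context: Conventions: $1/\infty=0$, $\infty-\ell=\infty$ for finite $\ell$, and $\exp(-\infty)=0$. (The left-hand side of the displayed equation is an upper bound on the probability that a betting wealth process $W_t$ with borrowing ever crosses the curve $g(L_t)$ of its liabilities $L_t$ under a supermartingale null; this interpretation is not needed for the statement.) *)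

(* Defs.v *)
From HB Require Import structures.
From mathcomp Require Import all_boot all_order all_algebra.
From mathcomp Require Import all_classical all_reals all_analysis.
Set Implicit Arguments.
Unset Strict Implicit.
Unset Printing Implicit Defensive.

(* The conventions 1/oo = 0, oo - l = oo for finite l, and exp(-oo) = 0 are
   those of the library's [inve], [adde] and [expeR] on [\bar R]. *)

(* Main.v *)
Require Import Defs.
From HB Require Import structures.
From mathcomp Require Import all_boot all_order all_algebra.
From mathcomp Require Import all_classical all_reals all_analysis.
From mathcomp Require Import lra.
Set Implicit Arguments.
Unset Strict Implicit.
Unset Printing Implicit Defensive.
Import Order.TTheory GRing.Theory Num.Theory.
Import numFieldNormedType.Exports.
Local Open Scope classical_set_scope.
Local Open Scope ring_scope.
Local Open Scope ereal_scope.

(** Write [a = g 0] and let [I] be the integral of [1 / g].  As [I >= 0], the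
    exponential factor [exp (- I)] is at most [1], so the left-hand side of the
    equation is at least [1 - (a - 1) / a = 1 / a], that is [1 / a <= alpha].
    If [a = 1 / alpha], then the equation leaves only [exp (- I) = 1], that is
    [I = 0] (the factor [(a - 1) / a] is nonzero, because [alpha < 1]).  But if
    [g l] were finite for some [l > 0], the monotonicity of [g l - l] would
    bound [g] by [g l] on [[0, l]], and [I] would be at least [l / g l > 0].
    The last bound is [integral_inv_gt0]; the equation enters through
    [expeR_factor_bound]. *)

(** The integral of a nonnegative function is the supremum of the integrals of
    the simple functions below it, and the step function [c] on [A] is one of
    them; [f] may thus be non-measurable. *)
Lemma integral_ge_step d (T : measurableType d) (R : realType)
    (mu : {measure set T -> \bar R}) (D A : set T) (f : T -> \bar R) (c : R) :
  measurable A -> A `<=` D -> (0 <= c)%R ->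
  (forall x, D x -> 0 <= f x) -> (forall x, A x -> c%:E <= f x) ->
  c%:E * mu A <= \int[mu]_(x in D) f x.
Proof.
move=> mA AD c0 f0 cf; rewrite ge0_integralE//.
apply: ereal_sup_ubound; exists (scale_nnsfun (indic_nnsfun R mA) c0) => /=.
  move=> x; rewrite measurable_realfun.mindicE; have [/set_mem Ax|nAx] := boolP (x \in A).
    by rewrite mulr1 patchT ?cf// inE; exact: AD.
  by rewrite mulr0; apply: erestrict_ge0.
by rewrite sintegralrM sintegral_indic.
Qed.

Lemma inve_ge0_ge1 (R : realType) (x : \bar R) : 1 <= x -> 0 <= 1 / x.
Proof. by move=> x1; rewrite mul1e inve_ge0 (le_trans _ x1). Qed.

(** A finite value [g l] bounds [g] on the whole of [[0, l]], so [1 / g] stays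
    above a positive constant there. *)
Lemma integral_inv_gt0 (R : realType) (g : R -> \bar R) (l : R) :
  (forall x : R, (0 <= x)%R -> 1 <= g x) ->
  (forall x y : R, (0 <= x)%R -> (x <= y)%R -> g x - x%:E <= g y - y%:E) ->
  (0 < l)%R -> g l < +oo ->
  0 < \int[lebesgue_measure]_(x in `[0%R, +oo[) (1 / g x).
Proof.
move=> g1 gincr l0 gl.
have gl1 := g1 _ (ltW l0); case: (g l) gl gl1 (gincr ^~ l) => // b _ b1 gb.
rewrite lee_fin in b1.
have b0 : (0 < b)%R by lra.
apply: (@lt_le_trans _ _ (b^-1%:E * lebesgue_measure `[0%R, l])).
  rewrite lebesgue_measure_itv/= lte_fin l0 sube0 -EFinM lte_fin.
  by rewrite mulr_gt0// invr_gt0.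
apply: integral_ge_step => //.
- by apply: subset_itvl.
- by rewrite invr_ge0 ltW.
- by move=> x /=; rewrite in_itv/= andbT => /g1; exact: inve_ge0_ge1.
move=> x /=; rewrite in_itv/= => /andP[x0 xl].
have := gb _ x0 xl; have := g1 _ x0.
case: (g x) => [r||]//; rewrite lee_fin => r1.
rewrite -!EFinB lee_fin => rb.
have r0 : (0 < r)%R by lra.
rewrite mul1e inver gt_eqF// lee_fin lef_pV2 ?posrE//; lra.
Qed.

(** Solving the equation for its exponential factor: [e <= 1] gives the lower
    bound on [a], and equality in it forces [e = 1]. *)
Lemma expeR_factor_bound (R : realType) (a e alpha : R) :
  (1 <= a)%R -> (0 < alpha < 1)%R -> (e <= 1)%R ->
  (1 - (a - 1) / a * e = alpha)%R ->
  (1 / alpha <= a)%R /\ (a = 1 / alpha -> e = 1)%R.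
Proof.
move=> a1 /andP[al0 al1] e1 E; have a0 : (0 < a)%R by lra.
have aE : (a - (a - 1) * e = alpha * a)%R.
  by rewrite -E [RHS]mulrBl mul1r mulrAC divfK ?gt_eqF.
split; first by rewrite ler_pdivrMr//; nra.
move=> aal; have aal1 : (alpha * a = 1)%R by rewrite aal mul1r mulfV ?gt_eqF.
have a1' : (a - 1 != 0)%R by apply/negP => /eqP h; nra.
by apply: (mulfI a1'); lra.
Qed.

Theorem proposition3p2 (R : realType) (g : R -> \bar R)
  (g_ge1 : forall l : R, (0 <= l)%R -> 1 <= g l)
  (g0_fin : g 0%R < +oo)
  (g_incr : forall l m : R, (0 <= l)%R -> (l <= m)%R ->
     g l - l%:E <= g m - m%:E)
  (alpha : R) (alpha_gt0 : (0 < alpha)%R) (alpha_lt1 : (alpha < 1)%R)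
  (g_alpha :
     1 - (g 0%R - 1) / g 0%R *
       expeR (- \int[lebesgue_measure]_(l in `[0%R, +oo[) (1 / g l))
     = alpha%:E) :
  [/\ (1 / alpha)%:E <= g 0%R,
      g 0%R = (1 / alpha)%:E -> forall l : R, (0 < l)%R -> g l = +oo
    & (exists2 l : R, (0 < l)%R & g l < +oo) -> (1 / alpha)%:E < g 0%R].
Proof.
have I_gt0 l : (0 < l)%R -> g l < +oo -> _ := integral_inv_gt0 g_ge1 g_incr.
have I_ge0 : 0 <= \int[lebesgue_measure]_(l in `[0%R, +oo[) (1 / g l).
  apply: integral_ge0 => x /=; rewrite in_itv/= andbT => /g_ge1.
  exact: inve_ge0_ge1.
move: I_gt0 I_ge0 g_alpha; set I := integral _ _ _ => I_gt0 I_ge0.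
have e_le1 : expeR (- I) <= 1 by rewrite -expeR0 lee_expeR oppe_le0.
have e_ge0 : 0 <= expeR (- I) := expeR_ge0 _.
have [e eE] : exists e, expeR (- I) = e%:E.
  exists (fine (expeR (- I))).
  by rewrite fineK// ge0_fin_numE// (le_lt_trans e_le1)// ltry.
have := g_ge1 0%R (lexx _); case g0E : (g 0%R) g0_fin => [a||]// _ a1.
rewrite eE lee_fin in a1 e_le1 *.
have a0 : (a != 0)%R by rewrite gt_eqF//; lra.
rewrite inver (negbTE a0) -EFinB => -[E].
have [|lb eq1] := expeR_factor_bound a1 _ e_le1 E; first exact/andP.
have g_infty : a = (1 / alpha)%R -> forall l : R, (0 < l)%R -> g l = +oo.
  move=> /eq1 e1 l l0; apply/eqP; rewrite -leye_eq leNgt; apply/negP => gl.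
  have := I_gt0 l l0 gl.
  have : expeR (- I) = expeR 0 by rewrite eE e1 expeR0.
  by move=> /expeR_inj/eqP; rewrite oppe_eq0 => /eqP ->; rewrite ltxx.
split => [|[]|[l l0 gl]]; [by rewrite lee_fin|exact: g_infty|].
rewrite lte_fin lt_neqAle lb andbT; apply/eqP => aE.
by move: gl; rewrite g_infty.
Qed.
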